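(* Let $\mathcal H$ be a real Hilbert space and let $f:\mathcal H\to\mathbb R$ be convex and Fréchet differentiable, with $L$-Lipschitz continuous gradient for some $L>0$, and with $\arg\min_{\mathcal H}f\neq\varnothing$. Let $0<s\le1/L$ and set $q=sL$. For $x,y\in\mathcal H$, define $X:=\nabla f(x)$ and $Y:=\nabla f(y)$. Then $$f(y-sY)\le f(x)+\langle Y,y-x\rangle-a\|Y\|^2-b\|X-Y\|^2,$$ where $$a:=s\left(1-\frac q2\right),\qquad b:=\frac1{2L}.$$ *)

(* Defs.v *)
From HB Require Import structures.
From mathcomp Require Import all_boot all_order all_algebra sesquilinear.
From mathcomp Require Import all_classical all_reals all_analysis.

Set Implicit Arguments.
Unset Strict Implicit.
Unset Printing Implicit Defensive.

Import Order.TTheory GRing.Theory Num.Theory.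
Import numFieldNormedType.Exports.

Local Open Scope classical_set_scope.
Local Open Scope ring_scope.

(* [inner] is the library's positive definite form for the trivial conjugation
   [idfun], i.e. a real inner product; [innerxx] says that the complete norm of
   [H] is the one induced by it. *)
HB.mixin Record CompleteNormedModule_isHilbert (R : realType) H
    of CompleteNormedModule R H := {
  inner : {dot H for (idfun : R -> R)} ;
  innerxx : forall x : H, inner x x = `|x| ^+ 2
}.

#[short(type="hilbertType")]
HB.structure Definition Hilbert (R : realType) :=
  {H of CompleteNormedModule R H & CompleteNormedModule_isHilbert R H}.

(* The Riesz representative of the Frechet differential: the vector [g] such
   that ['d f x h] is the inner product of [g] and [h] for all [h]. It is unique,
   and exists whenever [f] is differentiable at [x], [H] being complete. *)
Definition gradient (R : realType) (H : hilbertType R) (f : H -> R) (x : H) : H :=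
  get [set g : H | forall h : H, 'd f x h = inner g h].

Definition argmin (T : Type) (R : realType) (f : T -> R) : set T :=
  [set x | forall y, f x <= f y].

(* Main.v *)
Require Import Defs.
From HB Require Import structures.
From mathcomp Require Import all_boot all_order all_algebra sesquilinear.
From mathcomp Require Import all_classical all_reals all_analysis.
From mathcomp Require Import ring lra.

Set Implicit Arguments.
Unset Strict Implicit.
Unset Printing Implicit Defensive.

Import Order.TTheory GRing.Theory Num.Theory.
Import numFieldNormedType.Exports.

Local Open Scope classical_set_scope.
Local Open Scope ring_scope.

(** A gradient step from [y] lowers [f] by at least [a `|Y| ^+ 2]: this is the
    quadratic upper bound that a Lipschitz gradient imposes on [f]
    ([descent_inequality]), taken along [- s *: Y].  It remains to bound [f y]
    itself by [f x + inner Y (y - x) - b `|X - Y| ^+ 2]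
    ([convex_smooth_gap]), which sharpens the tangent inequality of convex
    functions.  There the affine minorant of [f] at [y] and the quadratic
    majorant of [f] at [x] are compared at the point
    [x - L^-1 *: (X - Y)], where the majorant minus the minorant is smallest;
    that smallest value is nonnegative, and it is exactly the gap claimed.

    All this needs the gradient to represent the differential.  The existence
    of the representative is the Riesz theorem ([riesz_representation]), obtained
    by minimizing the energy [h |-> `|h| ^+ 2 / 2 - phi h]: the
    parallelogram identity makes minimizing sequences Cauchy, and stationarity
    at the limit [g] says [phi = inner g]. *)

(** * Quadratic growth on a segment *)

(** The mean value theorem, applied on the unit interval to [g] minus the
    quadratic function with which it is compared: the derivative of the
    difference is nonpositive. *)
Lemma quadratic_growth (R : realType) (g dg : R -> R) (K : R) :
    (forall t : R, is_derive t 1 g (dg t)) ->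
    (forall t, 0 <= t <= 1 -> dg t - dg 0 <= t * K) ->
  g 1 <= g 0 + dg 0 + K / 2.
Proof.
move=> gE dg_le.
pose psi : R -> R := g - dg 0 \*: id - (K / 2) \*: (fun t : R => t ^+ 2).
have psiE (t : R) : is_derive t 1 psi (dg t - dg 0 - t * K).
  apply: is_derive_eq; rewrite /GRing.scale /=.
  by field.
have psi_cont : {within `[0, 1], continuous psi}.
  by apply: derivable_within_continuous => t _; exact: ex_derive.
have [c] := MVT_segment ler01 (fun t _ => psiE t) psi_cont.
rewrite in_itv => /dg_le dgc.
have psiV t : psi t = g t - dg 0 * t - K / 2 * t ^+ 2 by [].
by rewrite !psiV; lra.
Qed.

(** * Inner product and norm *)

Section inner_product.
Context {R : realType} {H : hilbertType R}.
Implicit Types (u v w g h : H) (k t : R).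

Lemma innerC u v : inner u v = inner v u.
Proof. by rewrite hermitian_subproof expr0 mul1r. Qed.

Lemma innerDl u v w : inner (u + v) w = inner u w + inner v w.
Proof. exact: linearDl. Qed.

Lemma innerBl u v w : inner (u - v) w = inner u w - inner v w.
Proof. exact: linearBl. Qed.

Lemma innerZl k u w : inner (k *: u) w = k * inner u w.
Proof. exact: linearZl_LR. Qed.

Lemma innerDr u v w : inner w (u + v) = inner w u + inner w v.
Proof. by rewrite !(innerC w) innerDl. Qed.

Lemma innerBr u v w : inner w (u - v) = inner w u - inner w v.
Proof. by rewrite !(innerC w) innerBl. Qed.

Lemma innerZr k u w : inner w (k *: u) = k * inner w u.
Proof. by rewrite !(innerC w) innerZl. Qed.

Lemma normD_sqr u v :
  `|u + v| ^+ 2 = `|u| ^+ 2 + 2 * inner u v + `|v| ^+ 2.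
Proof. by rewrite -!innerxx innerDl !innerDr (innerC v u); ring. Qed.

Lemma normB_sqr u v :
  `|u - v| ^+ 2 = `|u| ^+ 2 - 2 * inner u v + `|v| ^+ 2.
Proof. by rewrite -!innerxx innerBl !innerBr (innerC v u); ring. Qed.

Lemma normZ_sqr k u : `|k *: u| ^+ 2 = k ^+ 2 * `|u| ^+ 2.
Proof. by rewrite -!innerxx innerZl innerZr mulrA -expr2. Qed.

(** The Cauchy-Schwarz inequality, read off from the nonnegativity of
    [`| `|v| *: u - `|u| *: v| ^+ 2]. *)
Lemma inner_le_norm u v : inner u v <= `|u| * `|v|.
Proof.
have [->|u0] := eqVneq u 0.
  by rewrite -(scale0r (0 : H)) innerZl mul0r mulr_ge0.
have [->|v0] := eqVneq v 0.
  by rewrite -(scale0r (0 : H)) innerZr mul0r mulr_ge0.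
have uv0 : 0 < `|u| * `|v| by rewrite mulr_gt0 ?normr_gt0.
have polar (a b : H) : 0 <= `|a| ^+ 2 - 2 * inner a b + `|b| ^+ 2.
  by rewrite -normB_sqr sqr_ge0.
have := polar (`|v| *: u) (`|u| *: v).
rewrite !normZ_sqr innerZl innerZr => h.
rewrite -(ler_pM2l uv0); nra.
Qed.

(** * The Riesz representation *)

Definition energy (phi : H -> R) h := `|h| ^+ 2 / 2 - phi h.

(** The parallelogram identity: the linear part of the energy cancels.  Since the
    midpoint has energy at least the infimum, two points of almost minimal
    energy are close to each other. *)
Lemma energy_midpoint (phi : {linear H -> R^o}) u v :
  `|u - v| ^+ 2 = 4 * (energy phi u + energy phi v
                       - 2 * energy phi (2^-1 *: (u + v))).
Proof.
have phiE : phi (2^-1 *: (u + v)) = 2^-1 * (phi u + phi v) :> R.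
  by rewrite linearZ /= linearD.
rewrite /energy phiE normB_sqr normZ_sqr normD_sqr.
by field.
Qed.

(** Moving from the minimizer [g] along a line [t |-> g + t *: h] changes the
    energy by [t * (inner g h - phi h)] up to a term quadratic in [t]; a change
    that is never negative forces the linear coefficient to vanish. *)
Lemma energy_minimizer_represents (phi : {linear H -> R^o}) g :
  (forall h, energy phi g <= energy phi h) -> forall h, phi h = inner g h.
Proof.
move=> gmin h.
have quad t : 0 <= t * (inner g h - phi h) + t ^+ 2 * `|h| ^+ 2 / 2.
  have := gmin (g + t *: h).
  have phiE : phi (g + t *: h) = phi g + t * phi h :> R.
    by rewrite linearD linearZ.
  rewrite /energy phiE normD_sqr innerZr normZ_sqr; lra.
apply/eqP; rewrite eq_sym -subr_eq0; apply/eqP.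
move: quad; set d := _ - _; set N := `|h| ^+ 2 => quad.
have N0 : 0 <= N by exact: sqr_ge0.
(* The exact minimizer of the quadratic would be [- d / N]; the denominator
   [N + 1] avoids a case distinction for [N = 0]. *)
have {quad} := quad (- d / (N + 1)).
have -> : - d / (N + 1) * d + (- d / (N + 1)) ^+ 2 * N / 2
   = - (d ^+ 2 * ((N + 2) / (2 * (N + 1) ^+ 2))) by field; lra.
rewrite oppr_ge0 pmulr_lle0 ?divr_gt0 ?mulr_gt0 ?exprn_gt0//; try lra.
move=> d2; apply/eqP; rewrite -sqrf_eq0 eq_le d2 sqr_ge0 //.
Qed.

(** With [`|phi h| <= C * `|h|], completing the square in [`|h|] gives the bound
    [- C ^+ 2 / 2]. *)
Lemma energy_lbounded (phi : {linear H -> R^o}) :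
  continuous phi -> has_lbound (range (energy phi)).
Proof.
move=> /linear_bounded_continuous /linear_boundedP /pinfty_ex_gt0 [C C0 phiC].
exists (- (C ^+ 2 / 2)) => _ [h _ <-]; rewrite /energy.
have := phiC h; have := ler_norm (phi h : R).
have := sqr_ge0 (`|h| - C); rewrite sqrrB.
lra.
Qed.

Lemma energy_minimizer (phi : {linear H -> R^o}) :
  continuous phi -> exists g, forall h, energy phi g <= energy phi h.
Proof.
move=> phi_cont.
pose m := inf (range (energy phi)).
have lb := energy_lbounded phi_cont.
have hinf : has_inf (range (energy phi)).
  by split=> //; exists (energy phi 0), 0.
have m_le h : m <= energy phi h by apply: ge_inf => //; exists h.
have /choice [u uE] : forall n : nat, exists h, energy phi h < m + n.+1%:R^-1.
  move=> n; have := @inf_adherent _ _ (n.+1%:R^-1 : R) _ hinf.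
  by case=> [|_ [h _ <-] hlt]; [rewrite invr_gt0|exists h].
have u_cauchy : cvg (u @ \oo).
  apply/cauchy_cvgP/cauchy_ballP => _/posnumP[e]; near_simpl.
  have e8 : 0 < e%:num ^+ 2 / 8 :> R by rewrite divr_gt0 ?exprn_gt0.
  have close a b : energy phi a < m + e%:num ^+ 2 / 8 ->
      energy phi b < m + e%:num ^+ 2 / 8 -> ball a e%:num b.
    move=> ha hb; rewrite -ball_normE /ball_ /=.
    rewrite -(@ltr_pXn2r _ 2) ?nnegrE// (energy_midpoint phi).
    by have := m_le (2^-1 *: (a + b)); lra.
  have near_min : \forall n \near \oo, energy phi (u n) < m + e%:num ^+ 2 / 8.
    have := near_infty_natSinv_lt (PosNum e8); apply: filterS => n /= hn.
    by rewrite (lt_trans (uE n))// ltrD2l.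
  exists ([set n | energy phi (u n) < m + e%:num ^+ 2 / 8],
          [set n | energy phi (u n) < m + e%:num ^+ 2 / 8]) => //= -[a b] [].
  exact: close.
exists (lim (u @ \oo)) => h; apply: le_trans (m_le h).
have energy_cvg : energy phi (u n) @[n --> \oo] --> energy phi (lim (u @ \oo)).
  apply: (@cvgB R R^o); last by apply: continuous_cvg => //; exact: phi_cont.
  apply: cvgM; last exact: cvg_cst.
  by rewrite expr2; under eq_fun do rewrite expr2; apply: cvgM; exact: cvg_norm.
have inv_cvg : m + n.+1%:R^-1 @[n --> \oo] --> m + 0.
  by apply: cvgD; [exact: cvg_cst|exact: cvg_harmonic].
rewrite -[m]addr0; apply: ler_cvg_to energy_cvg inv_cvg _.
by apply: nearW => n; exact/ltW.
Unshelve. all: by end_near. Qed.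

Lemma riesz_representation (phi : {linear H -> R^o}) :
  continuous phi -> exists g, forall h, phi h = inner g h.
Proof.
move=> /energy_minimizer[g gmin]; exists g.
exact: energy_minimizer_represents.
Qed.

(** * Descent and tangent inequalities *)

Lemma gradientE (f : H -> R) x h :
  differentiable f x -> 'd f x h = inner (gradient f x) h.
Proof. by move=> /diff_continuous/riesz_representation/getPex; exact. Qed.

Section smooth.
Context (f : H -> R) (L : R) (f_diff : forall x, differentiable f x).

Lemma is_derive_line x h t :
  is_derive t 1 (fun r : R => f (x + r *: h)) (inner (gradient f (x + t *: h)) h).
Proof.
have line_diff : is_diff t (fun r : R => x + r *: h) (fun r => 0 + r *: h).
  exact: is_diffD.
have f_isdiff : is_diff (x + t *: h) f ('d f (x + t *: h)) by exact: DiffDef.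
have comp := is_diff_comp line_diff f_isdiff.
have comp_diff : differentiable (fun r : R => f (x + r *: h)) t by case: comp.
apply: DeriveDef; first exact: diff_derivable.
have /(congr1 (fun d => d 1)) /= := @diff_val _ _ _ _ _ _ _ comp.
by rewrite deriveE// add0r scale1r gradientE.
Qed.

Context (L_ge0 : 0 <= L) (gradf_lip : L.-lipschitz (gradient f)).

(** The displacement from [u] to [v] is measured against [h], because the lemma
    serves for points of a line of direction [h], visited in either order. *)
Lemma gradient_variation_le u v h t : `|u - v| <= t * `|h| ->
  inner (gradient f u) h - inner (gradient f v) h <= t * L * `|h| ^+ 2.
Proof.
move=> uv; rewrite -innerBl; apply: le_trans (inner_le_norm _ _) _.
rewrite expr2 mulrA ler_wpM2r//.
apply: le_trans (@gradf_lip (u, v) (conj I I)) _.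
by rewrite [t * L]mulrC -mulrA ler_wpM2l.
Qed.

Lemma descent_inequality x h :
  f (x + h) <= f x + inner (gradient f x) h + L / 2 * `|h| ^+ 2.
Proof.
have := @quadratic_growth R (fun t => f (x + t *: h))
  (fun t => inner (gradient f (x + t *: h)) h) (L * `|h| ^+ 2)
  (is_derive_line x h).
rewrite scale1r scale0r addr0 mulrAC; apply => t /andP[t0 _]; rewrite mulrA.
apply: gradient_variation_le.
by rewrite [x + _]addrC addrK normrZ ger0_norm.
Qed.

Context (f_convex : convex_function [set: H] f).

Lemma convex_segment x y t : 0 <= t -> t <= 1 ->
  f (x + t *: (y - x)) <= f x + t * (f y - f x).
Proof.
move=> t0 t1.
have t01 : Itv.spec (@Itv.num_sem R) (Itv.Real `[0%Z, 1%Z]) t.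
  by rewrite /= /Itv.num_sem num_real /= in_itv /= t0 t1.
have := @f_convex (Itv.mk t01) y x (in_setT _) (in_setT _).
have -> : x + t *: (y - x) = t *: y + (1 - t) *: x.
  by rewrite scalerBr scalerBl scale1r addrCA [x - _]addrC addrA.
move=> /le_trans; apply.
suff -> : f x + t * (f y - f x) = t * f y + (1 - t) * f x by [].
ring.
Qed.

(** No limit of difference quotients is taken: the upper bound of
    [descent_inequality], started from [x + t *: h] and read backwards, bounds
    [t * inner (gradient f x) h] by [f (x + t *: h) - f x] up to [O(t ^+ 2)],
    and convexity bounds this increment by [t * (f y - f x)].  Dividing by [t]
    leaves an error that is arbitrarily small. *)
Lemma convex_gradient_le x y :
  f x + inner (gradient f x) (y - x) <= f y.
Proof.
set h := y - x; pose C := (L / 2 + L) * `|h| ^+ 2.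
have C0 : 0 <= C by rewrite mulr_ge0// addr_ge0// divr_ge0.
have bound t : 0 < t -> t <= 1 -> inner (gradient f x) h <= f y - f x + t * C.
  move=> t0 t1; have := descent_inequality (x + t *: h) (- (t *: h)).
  have := convex_segment x y (ltW t0) t1; rewrite -/h.
  have : `|x - (x + t *: h)| <= t * `|h|.
    by rewrite opprD addNKr normrN normrZ gtr0_norm.
  move=> /gradient_variation_le.
  (* Only the bilinearity of the inner product matters from here on, so the two
     gradients become arbitrary vectors. *)
  move: (gradient f (x + t *: h)) (gradient f x) => Z X.
  rewrite /C addrK -scaleNr innerZr normZ_sqr sqrrN.
  move=> /(ler_wpM2l (ltW t0)) grad_le conv_le desc_le.
  rewrite -(ler_pM2l t0); lra.
rewrite addrC -lerBrDr; apply/ler_addgt0Pr => e e0.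
have [Ce|eC] := leP C e.
  by apply: le_trans (bound 1 ltr01 (lexx _)) _; rewrite mul1r lerD2l.
have C_gt0 : 0 < C by exact: lt_trans eC.
apply: le_trans (bound (e / C) _ _) _; rewrite ?divr_gt0//.
  by rewrite ler_pdivrMr// mul1r ltW.
by rewrite divfK ?gt_eqF.
Qed.

End smooth.

(** The auxiliary point [z] is a gradient step of length [L^-1] from [x] for the
    convex function [f - inner (gradient f y)], which is minimal at [y]: that
    step lowers it by the last term, and not below its value at [y]. *)
Lemma convex_smooth_gap (f : H -> R) (L : R) x y :
  (forall x, differentiable f x) -> 0 < L -> L.-lipschitz (gradient f) ->
  convex_function [set: H] f ->
  f y <= f x + inner (gradient f y) (y - x)
         - 1 / (2 * L) * `|gradient f x - gradient f y| ^+ 2.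
Proof.
move=> f_diff L0 lip cvx.
pose z := x - L^-1 *: (gradient f x - gradient f y).
have := descent_inequality f_diff (ltW L0) lip x
  (- (L^-1 *: (gradient f x - gradient f y))).
have := convex_gradient_le f_diff (ltW L0) lip cvx y z.
rewrite /z; move: (gradient f x) (gradient f y) => X Y.
rewrite -scaleNr normZ_sqr !(innerBr, innerDr, innerZr).
have -> : L / 2 * ((- L^-1) ^+ 2 * `|X - Y| ^+ 2) = L^-1 / 2 * `|X - Y| ^+ 2.
  by field; rewrite gt_eqF.
have -> : 1 / (2 * L) * `|X - Y| ^+ 2 = L^-1 / 2 * `|X - Y| ^+ 2.
  by field; rewrite gt_eqF.
rewrite normB_sqr -!innerxx (innerC X Y).
lra.
Qed.

End inner_product.

Theorem proposition3p1 (R : realType) (H : hilbertType R) (f : H -> R)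
    (L s : R)
    (f_convex : convex_function [set: H] f)
    (f_diff : forall x : H, differentiable f x)
    (L_gt0 : 0 < L)
    (gradf_lip : L.-lipschitz (gradient f))
    (argmin_neq0 : argmin f !=set0)
    (s_gt0 : 0 < s) (s_le : s <= 1 / L)
    (x y : H) :
  let q := s * L in
  let X := gradient f x in
  let Y := gradient f y in
  let a := s * (1 - q / 2) in
  let b := 1 / (2 * L) in
  f (y - s *: Y) <=
    f x + inner Y (y - x) - a * `|Y| ^+ 2 - b * `|X - Y| ^+ 2.
Proof.
cbv zeta.
have := descent_inequality f_diff (ltW L_gt0) gradf_lip y
  (- (s *: gradient f y)).
have := convex_smooth_gap x y f_diff L_gt0 gradf_lip f_convex.
move: (gradient f x) (gradient f y) => X Y gap.
rewrite -scaleNr innerZr innerxx normZ_sqr; lra.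
Qed.
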